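(* For every integer $n\geq 5$, the eccentricity matrix $E(W_n)$ of the wheel graph $W_n$ on $n$ vertices is not a Euclidean distance matrix.
   Context: A real square matrix $M=(m_{ij})$ of order $n$ is a Euclidean distance matrix if there exist (for some $r$) $n$ vectors $\mathbf{x_1},\dots,\mathbf{x_n}\in\mathbb{R}^r$ such that $m_{ij}=\|\mathbf{x_i}-\mathbf{x_j}\|_2^2$ for all $i,j$, where $\|\cdot\|_2$ is the Euclidean norm. For a simple connected graph $G$ with vertices $v_1,\dots,v_n$, let $d(v_i,v_j)$ be the length of a shortest path between $v_i$ and $v_j$, and let $e(v_i)=\max\{d(v_i,v_j):1\le j\le n\}$ be the eccentricity of $v_i$. The eccentricity matrix $E(G)$ is the $n\times n$ real matrix with $(E(G))_{ij}=d(v_i,v_j)$ if $d(v_i,v_j)=\min\{e(v_i),e(v_j)\}$, and $(E(G))_{ij}=0$ otherwise. The wheel graph $W_n$ is the graph on $n$ vertices consisting of a cycle of length $n-1$ together with one further vertex (the hub) adjacent to every vertex of the cycle. The vertices are labelled so that $v_1$ is the hub and $v_2,\dots,v_n$ are the cycle vertices in cyclic order. *)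

(* Defs.v *)
From mathcomp Require Import all_boot all_order all_algebra.
From mathcomp Require Import reals.

Set Implicit Arguments.
Unset Strict Implicit.
Unset Printing Implicit Defensive.

Import Order.TTheory GRing.Theory Num.Theory.
Local Open Scope ring_scope.

(* The norm carried by 'rV[R]_r in MathComp-Analysis is the sup norm. *)
Definition euclidean_norm (R : realType) (r : nat) (x : 'rV[R]_r) : R :=
  Num.sqrt (\sum_(k < r) x ord0 k ^+ 2).

Definition is_euclidean_distance_matrix (R : realType) (n : nat)
    (M : 'M[R]_n) : Prop :=
  exists (r : nat) (x : 'I_n -> 'rV[R]_r),
    forall i j : 'I_n, M i j = euclidean_norm (x i - x j) ^+ 2.

Section Graph.
Local Open Scope nat_scope.
Variables (T : finType) (e : rel T).

Definition has_path_of_length (x y : T) (k : nat) : bool :=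
  [exists p : k.-tuple T,
    [&& path e x p, last x p == y & uniq (x :: p)]].

(* A path has at most #|T| - 1 edges, so this is the least length of a path
   from x to y; the junk value #|T| is taken when there is no path. *)
Definition graph_dist (x y : T) : nat :=
  find (has_path_of_length x y) (iota 0 #|T|).

Definition eccentricity (x : T) : nat := \max_(y : T) graph_dist x y.

Lemma has_path_of_lengthP (x y : T) (k : nat) :
  reflect (exists p : seq T,
             [/\ path e x p, last x p = y, uniq (x :: p) & size p = k])
          (has_path_of_length x y k).
Proof.
apply: (iffP existsP) => [[p /and3P[ep /eqP lp up]]|[p [ep lp up sp]]].
  by exists p; rewrite size_tuple.
by exists (Tuple (introT eqP sp)); rewrite /= ep lp eqxx.
Qed.

Lemma graph_distP (x y : T) : connect e x y ->
  has_path_of_length x y (graph_dist x y) /\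
  (forall k, has_path_of_length x y k -> graph_dist x y <= k).
Proof.
have bound k : has_path_of_length x y k -> k < #|T|.
  case/has_path_of_lengthP => p [_ _ up <-].
  by rewrite -[_.+1]/(size (x :: p)) -(card_uniqP up) max_card.
case/connectP => p0 ep0 y_def.
have [k kP] : exists k, has_path_of_length x y k.
  case/shortenP: ep0 y_def => p ep up _ y_def.
  by exists (size p); apply/has_path_of_lengthP; exists p.
have hasP : has (has_path_of_length x y) (iota 0 #|T|).
  by apply/hasP; exists k; rewrite // mem_iota bound.
split.
  have := nth_find 0 hasP; rewrite nth_iota //.
  by move: hasP; rewrite has_find size_iota.
move=> j jP; rewrite leqNgt; apply/negP => lt_j.
have := before_find 0 lt_j.
by rewrite nth_iota ?bound // add0n jP.
Qed.

End Graph.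

Definition eccentricity_matrix (R : realType) (n : nat) (e : rel 'I_n) :
    'M[R]_n :=
  \matrix_(i, j)
    if graph_dist e i j == minn (eccentricity e i) (eccentricity e j)
    then (graph_dist e i j)%:R else 0.

Section Wheel.
Local Open Scope nat_scope.
Variable n : nat.

(* Cyclic successor on the rim labels 1, ..., n - 1. *)
Definition rim_succ (i : nat) : nat := if i.+1 == n then 1 else i.+1.

(* Labels start at 0: the hub is 0 and the rim vertices are 1, ..., n - 1
   in cyclic order. *)
Definition wheel : rel 'I_n := fun i j =>
  (i != j) &&
  [|| val i == 0, val j == 0, val j == rim_succ i | val i == rim_succ j].

Lemma wheel_sym : symmetric wheel.
Proof.
move=> i j; rewrite /wheel eq_sym orbCA.
by rewrite (orbC (val j == rim_succ i)).
Qed.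

Lemma wheel_irr : irreflexive wheel.
Proof. by move=> i; rewrite /wheel eqxx. Qed.

Lemma wheel_connected (i j : 'I_n) : connect wheel i j.
Proof.
have n_gt0 : 0 < n by apply: leq_ltn_trans (ltn_ord i).
have hub k : connect wheel (Ordinal n_gt0) k.
  have [<-|neq] := eqVneq (Ordinal n_gt0) k; first exact: connect0.
  by apply: connect1; rewrite /wheel neq.
apply: connect_trans (hub j).
by rewrite (sym_connect_sym wheel_sym) hub.
Qed.

End Wheel.

(* Main.v *)
(** Consecutive rim vertices have distance 1 but eccentricity 2, so their entry
    in the eccentricity matrix vanishes and a Euclidean realization has to
    identify them. Hence the rim vertices 1, 2, 3 are all mapped to the same
    point, whereas the entry of the non-adjacent pair (1, 3) is 2. *)
Require Import Defs.
From mathcomp Require Import all_boot all_order all_algebra.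
From mathcomp Require Import reals.

Import Order.TTheory GRing.Theory Num.Theory.

Lemma euclidean_norm_eq0 (R : realType) (r : nat) (x : 'rV[R]_r) :
  (euclidean_norm x == 0)%R = (x == 0)%R.
Proof.
have sum_ge0 : (0 <= \sum_(k < r) x ord0 k ^+ 2)%R.
  by apply: sumr_ge0 => k _; exact: sqr_ge0.
(* [Num.sqrt] is 0 on every nonpositive real, so its vanishing only bounds the sum above by 0;
   [sum_ge0] makes this an equality. *)
rewrite /euclidean_norm sqrtr_eq0 le_eqVlt ltNge sum_ge0 orbF.
rewrite psumr_eq0 => [|k _]; last exact: sqr_ge0.
apply/allP/eqP => [x0|-> k _ /=]; last by rewrite mxE expr0n.
apply/rowP => k; rewrite mxE; apply/eqP; rewrite -sqrf_eq0.
exact: (implyP (x0 k (mem_index_enum k))).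
Qed.

(** The hub is adjacent to every other vertex, so two distinct non-adjacent vertices are joined by a
    path of length 2 through it. *)
Lemma wheel_dist (n : nat) (i j : 'I_n) :
  graph_dist (@wheel n) i j = if i == j then 0 else (~~ wheel i j).+1.
Proof.
have [+ le_dist] := graph_distP (wheel_connected i j).
have [eq_ij _|neq_ij] := eqVneq i j.
  apply/eqP; rewrite -leqn0; apply: le_dist.
  by apply/has_path_of_lengthP; exists [::].
case/has_path_of_lengthP => p [ep lp _ sp].
case e_ij: (wheel i j) => /=.
  have le1 : graph_dist (@wheel n) i j <= 1.
    apply: le_dist; apply/has_path_of_lengthP; exists [:: j].
    by rewrite /= e_ij mem_seq1 neq_ij.
  move: p ep lp sp le1 => [|a [|b p]] _ /= lp <- //.
  by rewrite lp eqxx in neq_ij.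
have n_gt0 : 0 < n by apply: leq_ltn_trans (ltn_ord i).
pose hub := Ordinal n_gt0.
(* If [i] or [j] were the hub, they would be adjacent. *)
have [neq_i0 neq_j0] : i != hub /\ hub != j.
  split; apply: contraFneq e_ij; rewrite /wheel neq_ij.
    by move=> ->.
  by move=> <-; rewrite orbT.
have le2 : graph_dist (@wheel n) i j <= 2.
  apply: le_dist; apply/has_path_of_lengthP; exists [:: hub; j].
  by rewrite /= !inE !negb_or /wheel neq_i0 neq_j0 neq_ij /= orbT.
move: p ep lp sp le2 => [|a [|b [|c p]]] /= ep lp <- // _.
  by rewrite lp eqxx in neq_ij.
by move: ep; rewrite lp e_ij.
Qed.

Lemma wheel_eccentricity (n : nat) (i j : 'I_n) :
  i != j -> ~~ wheel i j -> eccentricity (@wheel n) i = 2.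
Proof.
move=> neq_ij e_ij; apply/eqP; rewrite eqn_leq; apply/andP; split.
  by apply/bigmax_leqP => k _; rewrite wheel_dist; case: eqP => // _; case: wheel.
apply: leq_trans (leq_bigmax j).
by rewrite wheel_dist (negPf neq_ij) e_ij.
Qed.

Theorem proposition2p5 (R : realType) (n : nat) (hn : (5 <= n)%N) :
  ~ is_euclidean_distance_matrix (eccentricity_matrix R (@wheel n)).
Proof.
case: n hn => [|[|[|[|[|n]]]]] // _ [r [x edm]].
pose v k : 'I_n.+4.+1 := inord k.
have vE k : k < 5 -> v k = k :> nat by move=> k5; rewrite inordK // (leq_trans k5).
have neqE k l : k < 5 -> l < 5 -> (v k == v l) = (k == l).
  by move=> k5 l5; rewrite -val_eqE /= !vE.
have e12 : wheel (v 1) (v 2) by rewrite /wheel neqE //= !vE.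
have e23 : wheel (v 2) (v 3) by rewrite /wheel neqE //= !vE.
have e13 : ~~ wheel (v 1) (v 3) by rewrite /wheel neqE //= !vE.
(* Vertex 4 witnesses that vertex 2 has eccentricity 2. Its successor is 1 if the wheel has five
   vertices and 5 otherwise, hence never 2. *)
have e24 : ~~ wheel (v 2) (v 4).
  by rewrite /wheel neqE //= !vE // /rim_succ; case: (5 == _).
have ecc1 : eccentricity (@wheel n.+4.+1) (v 1) = 2.
  by apply: wheel_eccentricity e13; rewrite neqE.
have ecc2 : eccentricity (@wheel n.+4.+1) (v 2) = 2.
  by apply: wheel_eccentricity e24; rewrite neqE.
have ecc3 : eccentricity (@wheel n.+4.+1) (v 3) = 2.
  by apply: (@wheel_eccentricity _ _ (v 1)); rewrite ?neqE // wheel_sym.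
have x_eq k l : eccentricity (@wheel n.+4.+1) k = 2 ->
    eccentricity (@wheel n.+4.+1) l = 2 -> wheel k l -> x k = x l.
  move=> ecck eccl e_kl; apply/eqP.
  rewrite -subr_eq0 -euclidean_norm_eq0 -sqrf_eq0 -edm mxE wheel_dist.
  (* The distance is 0 or 1 according to [k == l]; neither equals the minimum 2, so the entry is 0
     in both cases. *)
  by rewrite ecck eccl e_kl; case: (k == l).
have := edm (v 1) (v 3).
rewrite (x_eq _ _ ecc1 ecc2 e12) (x_eq _ _ ecc2 ecc3 e23) subrr.
have /eqP -> : (euclidean_norm (0 : 'rV[R]_r) == 0)%R by rewrite euclidean_norm_eq0.
rewrite mxE wheel_dist neqE // e13 ecc1 ecc3 /= expr0n /=.
by apply/eqP; rewrite pnatr_eq0.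
Qed.
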